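(* The bracket polynomial $\langle\langle\ \cdot\ \rangle\rangle$ for tied links satisfies: (i) $\langle\langle D'\rangle\rangle=-A^{3}\langle\langle D\rangle\rangle$ whenever $D'$ is obtained from $D$ by inserting a positive curl in a strand; (ii) $\langle\langle D'\rangle\rangle=-A^{-3}\langle\langle D\rangle\rangle$ whenever $D'$ is obtained from $D$ by inserting a negative curl in a strand. Moreover, $\langle\langle\ \cdot\ \rangle\rangle$ coincides with the Kauffman bracket polynomial on classical knots, and on classical links provided that they are considered as tied links whose components are all tied together.
   Context: $A,c$ are commuting independent variables. A tied link is a link together with a partition of the set of its components, depicted by ties; components in the same subset are said to be tied together. An unoriented tied link diagram is a (nonempty) unoriented link diagram in $S^2$ together with a partition of the set of components. A positive (negative) curl is a one-crossing kink (Reidemeister I) whose crossing has sign $+1$ ($-1$). $\langle\langle\ \cdot\ \rangle\rangle$ is the unique function from unoriented tied link diagrams to $\mathbb{Z}[A^{\pm1},c]$ such that: (i) it is $1$ on the crossingless circle $O$; (ii) $\langle\langle O\sqcup D\rangle\rangle=c\langle\langle D\rangle\rangle$, where the added crossingless circle is not tied to $D$; (iii) $\langle\langle O\,\widetilde{\sqcup}\,D\rangle\rangle=-(A^2+A^{-2})\langle\langle D\rangle\rangle$, where the added crossingless circle is tied to a component of $D$; (iv) it is invariant under Reidemeister moves II and III (keeping the partition); (v) $\langle\langle D\rangle\rangle=A\langle\langle D_A\rangle\rangle+A^{-1}\langle\langle D_B\rangle\rangle$ for a crossing of $D$ whose strands belong to the same component or to components tied together, where $D_A,D_B$ are the $A$-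 and $B$-smoothings with a tie joining the two arcs; (vi) $\langle\langle D_+\rangle\rangle+\langle\langle D_-\rangle\rangle=(A+A^{-1})(\langle\langle D_e\rangle\rangle+\langle\langle D_f\rangle\rangle)$ for diagrams identical outside a disc and inside it equal to a crossing, the opposite crossing, and the two smoothings, each with a tie joining its two arcs. (A tie joining the two arcs of a smoothing puts all components through the disc, and all other components that before smoothing belonged to the classes of the strands at the crossing, into one class.) The $A$-smoothing joins the two regions swept out when the overcrossing strand is rotated counterclockwise onto the undercrossing strand. The Kauffman bracket is the function on classical unoriented link diagrams with $\langle O\rangle=1$, $\langle O\sqcup D\rangle=-(A^2+A^{-2})\langle D\rangle$, $\langle D\rangle=A\langle D_A\rangle+A^{-1}\langle D_B\rangle$. *)

(* Defs.v *)
From HB Require Import structures.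
From mathcomp Require Import all_boot all_algebra.
From mathcomp Require boolp.
From Stdlib Require Import Relation_Operators.

Set Implicit Arguments.
Unset Strict Implicit.
Unset Printing Implicit Defensive.

Import GRing.Theory.

(******************************************************************************)
(* The coefficient rings Z[A, A^-1] and Z[A, A^-1, c].                        *)
(******************************************************************************)
Section Laurent.
Local Open Scope ring_scope.

Local Notation fracX := (tofrac ('X : {poly int})).

(* Z[A, A^-1], as a subring of the fraction field of Z[A]. *)
Definition is_laurent : {pred {fraction {poly int}}} := fun x =>
  boolp.asbool (exists (n : nat) (p : {poly int}),
    x * fracX ^+ n = tofrac p).

Lemma is_laurentP x :
  reflect (exists (n : nat) (p : {poly int}),
             x * fracX ^+ n = tofrac p) (x \in is_laurent).
Proof. exact: boolp.asboolP. Qed.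

Lemma is_laurent_subring : subring_closed is_laurent.
Proof.
split=> [|x y /is_laurentP[n [p xE]] /is_laurentP[m [q yE]]
         |x y /is_laurentP[n [p xE]] /is_laurentP[m [q yE]]];
  apply/is_laurentP.
- by exists 0%N, 1; rewrite mulr1 rmorph1.
- exists (n + m)%N, (p * 'X^m - q * 'X^n).
  rewrite rmorphB !rmorphM !rmorphXn /= -xE -yE mulrBl !exprD !mulrA.
  by congr (_ - _); rewrite mulrAC.
- exists (n + m)%N, (p * q).
  by rewrite rmorphM /= -xE -yE exprD mulrACA.
Qed.

HB.instance Definition _ :=
  GRing.isSubringClosed.Build _ is_laurent is_laurent_subring.

Record laurent : predArgType :=
  Laurent { laurent_val :> {fraction {poly int}};
            laurent_valP : laurent_val \in is_laurent }.

HB.instance Definition _ := [isSub for laurent_val].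
HB.instance Definition _ := [Choice of laurent by <:].
HB.instance Definition _ := [SubChoice_isSubComNzRing of laurent by <:].

Lemma varA_subproof : fracX \in is_laurent.
Proof. by apply/is_laurentP; exists 0%N, 'X; rewrite mulr1. Qed.

Lemma X_frac_neq0 : fracX != 0.
Proof. by rewrite tofrac_eq0 polyX_eq0. Qed.

Lemma varAi_subproof : fracX^-1 \in is_laurent.
Proof.
by apply/is_laurentP; exists 1%N, 1; rewrite expr1 mulVf ?X_frac_neq0 ?rmorph1.
Qed.

Definition varA : laurent := Laurent varA_subproof.
Definition varAi : laurent := Laurent varAi_subproof.

Lemma varA_mulV : varA * varAi = 1.
Proof. by apply: val_inj; rewrite rmorphM rmorph1 /= mulfV ?X_frac_neq0. Qed.

End Laurent.

(* Z[A, A^-1, c] is {poly laurent}; its indeterminate 'X plays the role of c. *)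
Notation bracket_ring := {poly laurent}.

(******************************************************************************)
(* Link diagrams in S^2.                                                      *)
(*                                                                            *)
(* A diagram in the plane is isotopic to one in general position with respect *)
(* to a height function, i.e. to a vertical stack of layers, read upwards,    *)
(* each containing one local minimum (Cup), one local maximum (Cap) or one    *)
(* crossing of two upright strands, beside straight vertical strands. The     *)
(* layer (i, e) has its elementary piece e to the right of exactly i vertical *)
(* strands; positions count from 0.                                           *)
(* In Cross true the strand running from bottom left to top right is the over *)
(* strand; if both strands are directed upwards (or both downwards) the       *)
(* crossing has sign +1. In Cross false it is the under strand: sign -1.      *)
(*                                                                            *)
(* The components are coloured by elements of T. A tied link diagram is a     *)
(* diagram coloured by nat, two components being in the same class of the     *)
(* partition iff they have the same colour; names of colours carry no         *)
(* information (see class_renaming in is_tied_bracket). A classical diagram   *)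
(* is a diagram coloured by unit.                                             *)
(******************************************************************************)
Inductive piece (T : Type) : Type :=
  | Cup of T
  | Cap
  | Cross of bool.
Arguments Cap {T}.
Arguments Cross {T}.

Definition layer (T : Type) : Type := (nat * piece T)%type.

Section Diagrams.
Variable T : eqType.
Implicit Types (s : seq T) (w u v a b : seq (layer T)) (x y : T).

(* The colours, from left to right, of the strands leaving a layer upwards,
   given those of the strands entering it; None if the layer does not fit. *)
Definition run_layer s (l : layer T) : option (seq T) :=
  let: (i, e) := l in
  match e with
  | Cup x => if i <= size s then Some (take i s ++ x :: x :: drop i s) else None
  | Cap => if drop i s is x :: y :: r then
             if x == y then Some (take i s ++ r) else None
           else None
  | Cross _ => if drop i s is x :: y :: r then Some (take i s ++ y :: x :: r)
               else None
  end.

Fixpoint run s w : option (seq T) :=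
  if w is l :: w' then obind (run^~ w') (run_layer s l) else Some s.

Definition is_diagram w : bool := ~~ nilp w && (run [::] w == Some [::]).

Record diagram : Type := Diagram { word : seq (layer T); _ : is_diagram word }.
Implicit Types D : diagram.

Definition class_used w x : Prop := exists t i, onth w t = Some (i, Cup x).

(* D' results from D by replacing the part a of the picture by b. *)
Definition replaced a b D D' : Prop :=
  exists u v, word D = u ++ a ++ v /\ word D' = u ++ b ++ v.

Definition n_in (e : piece T) : nat := if e is Cup _ then 0 else 2.
Definition n_out (e : piece T) : nat := if e is Cap then 0 else 2.

Definition shift w : seq (layer T) := [seq (l.1.+1, l.2) | l <- w].

Inductive planar_move : seq (layer T) -> seq (layer T) -> Prop :=
  | move_far i j e e' : i + n_in e <= j ->
      planar_move [:: (j, e'); (i, e)] [:: (i, e); (j - n_in e + n_out e, e')]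
  | move_zigzag_l i x : planar_move [:: (i.+1, Cup x); (i, Cap)] [::]
  | move_zigzag_r i x : planar_move [:: (i, Cup x); (i.+1, Cap)] [::]
  | move_cup_slide i x e :
      planar_move [:: (i, Cup x); (i.+1, Cross e)]
                  [:: (i.+1, Cup x); (i, Cross (~~ e))]
  | move_cap_slide i e :
      planar_move [:: (i.+1, Cross e); (i, Cap)]
                  [:: (i, Cross (~~ e)); (i.+1, Cap)].

(* Isotopy in S^2: planar isotopy of stacks of layers, and iso_infinity, which
   swings the closing arc of a long tangle w (one strand in, one strand out)
   from its right side to its left side across the point at infinity. *)
Inductive isotopic : diagram -> diagram -> Prop :=
  | iso_planar a b D D' :
      planar_move a b -> replaced a b D D' -> isotopic D D'
  | iso_infinity x w D D' :
      run [:: x] w = Some [:: x] ->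
      word D = (0, Cup x) :: w ++ [:: (0, Cap)] ->
      word D' = (0, Cup x) :: shift w ++ [:: (0, Cap)] -> isotopic D D'
  | iso_refl D : isotopic D D
  | iso_sym D D' : isotopic D D' -> isotopic D' D
  | iso_trans D D' D'' : isotopic D D' -> isotopic D' D'' -> isotopic D D''.

Definition reidemeister2 D D' : Prop :=
  exists i e, replaced [:: (i, Cross e); (i, Cross (~~ e))] [::] D D'.

(* The three strands are pairwise crossing; the side condition excludes that
   they lie cyclically above each other. *)
Definition reidemeister3 D D' : Prop :=
  exists i e1 e2 e3, ~ (e1 = e3 /\ e2 = ~~ e1) /\
    replaced [:: (i, Cross e1); (i.+1, Cross e2); (i, Cross e3)]
             [:: (i.+1, Cross e3); (i, Cross e2); (i.+1, Cross e1)] D D'.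

Definition is_circle D : Prop := exists x, word D = [:: (0, Cup x); (0, Cap)].

(* D' is D with a crossingless circle of colour x added in some region of D. *)
Definition circle_added x D D' : Prop :=
  exists i, replaced [::] [:: (i, Cup x); (i, Cap)] D D'.

(* The two smoothings of a crossing at position i: two upright arcs, or a cap
   below a cup. The A-smoothing of Cross e is smoothing e, the B-smoothing is
   smoothing (~~ e). *)
Definition smoothing (upright : bool) i x : seq (layer T) :=
  if upright then [::] else [:: (i, Cap); (i, Cup x)].

(* A kink to the right or to the left of the i-th strand. Along the kink the
   crossing is traversed twice upwards (or twice downwards), so the sign of
   Cross e is +1 if e is true, and -1 otherwise. *)
Definition curl (e right_side : bool) i x : seq (layer T) :=
  if right_side then [:: (i.+1, Cup x); (i, Cross e); (i.+1, Cap)]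
  else [:: (i, Cup x); (i.+1, Cross e); (i, Cap)].

Definition curl_inserted (e : bool) D D' : Prop :=
  exists right_side i x, replaced [::] (curl e right_side i x) D D'.

(* (t, j) is the j-th strand at the level just below the layer number t. *)
Definition strand_point D (p : nat * nat) : Prop :=
  exists s, run [::] (take p.1 (word D)) = Some s /\ p.2 < size s.

Inductive joined D : nat * nat -> nat * nat -> Prop :=
  | joined_left t i e j : onth (word D) t = Some (i, e) ->
      j < i -> joined D (t, j) (t.+1, j)
  | joined_right t i e j : onth (word D) t = Some (i, e) ->
      i + n_in e <= j -> joined D (t, j) (t.+1, j - n_in e + n_out e)
  | joined_cup t i x : onth (word D) t = Some (i, Cup x) ->
      joined D (t.+1, i) (t.+1, i.+1)
  | joined_cap t i : onth (word D) t = Some (i, Cap) ->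
      joined D (t, i) (t, i.+1)
  | joined_cross_r t i e : onth (word D) t = Some (i, Cross e) ->
      joined D (t, i) (t.+1, i.+1)
  | joined_cross_l t i e : onth (word D) t = Some (i, Cross e) ->
      joined D (t, i.+1) (t.+1, i).

(* A knot is a link with exactly one component. *)
Definition is_knot D : Prop := forall p q,
  strand_point D p -> strand_point D q -> clos_refl_sym_trans _ (joined D) p q.

(* The i-th strand at the top of the partial diagram u has colour x. *)
Definition strand_class u i x : Prop :=
  exists s, run [::] u = Some s /\ onth s i = Some x.

End Diagrams.

Section Recolouring.
Variables (T T' : eqType) (h : T -> T').

Definition recolor_piece (e : piece T) : piece T' :=
  match e with Cup x => Cup (h x) | Cap => Cap | Cross b => Cross b end.

Definition recolor_word (w : seq (layer T)) : seq (layer T') :=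
  [seq (l.1, recolor_piece l.2) | l <- w].

Lemma run_layer_recolor s s' i e :
  run_layer s (i, e) = Some s' ->
  run_layer (map h s) (i, recolor_piece e) = Some (map h s').
Proof.
case: e => [x||b] /=; rewrite -?map_drop.
- rewrite size_map; case: ifP => // _ [<-].
  by rewrite map_cat map_take /= map_drop.
- case: (drop i s) => [|x [|y r]] //=.
  by case: eqP => // -> [<-]; rewrite eqxx map_cat map_take.
- case: (drop i s) => [|x [|y r]] //= [<-].
  by rewrite map_cat map_take.
Qed.

Lemma run_recolor s s' w :
  run s w = Some s' -> run (map h s) (recolor_word w) = Some (map h s').
Proof.
elim: w s => [|[i e] w IHw] s; first by case=> <-.
have runE (T1 : eqType) (s1 : seq T1) l w1 :
  run s1 (l :: w1) = obind (fun s2 => run s2 w1) (run_layer s1 l) by [].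
rewrite [recolor_word _]/= !runE.
case run_e: (run_layer s (i, e)) => [s1|] // run_w.
by rewrite (run_layer_recolor run_e); apply: IHw.
Qed.

Lemma recolor_subproof (D : diagram T) : is_diagram (recolor_word (word D)).
Proof.
case: D => w /= /andP[w_neq0 /eqP/run_recolor/= run_w].
by rewrite /is_diagram run_w eqxx andbT /nilp size_map.
Qed.

Definition recolor (D : diagram T) : diagram T' :=
  Diagram (recolor_subproof D).

End Recolouring.

Definition classical_diagram : Type := diagram unit.
Definition tied_diagram : Type := diagram nat.

Definition forget_ties (D : tied_diagram) : classical_diagram :=
  recolor (fun=> tt) D.

Definition tie_all (D : classical_diagram) : tied_diagram :=
  recolor (fun=> 0) D.

(* The smoothing of the crossing at position i between the parts u and v of a
   tied diagram, with a tie joining its arcs: the classes x and y of the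
   strands at the crossing are united in the whole diagram. *)
Definition merge (x y z : nat) : nat := if z == y then x else z.

Definition tied_smoothing (u v : seq (layer nat)) (upright : bool)
    (i x y : nat) : seq (layer nat) :=
  recolor_word (merge x y) u ++ smoothing upright i x
    ++ recolor_word (merge x y) v.

Section Brackets.
Local Open Scope ring_scope.

Record is_kauffman_bracket (K : classical_diagram -> laurent) : Prop := {
  kauffman_isotopy : forall D D', isotopic D D' -> K D = K D';
  kauffman_circle : forall D, is_circle D -> K D = 1;
  kauffman_add_circle : forall D D', circle_added tt D D' ->
    K D' = - (varA ^+ 2 + varAi ^+ 2) * K D;
  kauffman_skein : forall D DA DB u v i e,
    word D = u ++ (i, Cross e) :: v ->
    word DA = u ++ smoothing e i tt ++ v ->
    word DB = u ++ smoothing (~~ e) i tt ++ v ->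
    K D = varA * K DA + varAi * K DB }.

Local Notation A := (varA%:P).
Local Notation Ai := (varAi%:P).
Local Notation c := ('X : bracket_ring).

Record is_tied_bracket (f : tied_diagram -> bracket_ring) : Prop := {
  bracket_isotopy : forall D D', isotopic D D' -> f D = f D';
  class_renaming : forall (D : tied_diagram) (h : nat -> nat),
    (forall x y, class_used (word D) x -> class_used (word D) y ->
       h x = h y -> x = y) ->
    f (recolor h D) = f D;
  bracket_circle : forall D, is_circle D -> f D = 1;
  bracket_free_circle : forall D D' x,
    circle_added x D D' -> ~ class_used (word D) x -> f D' = c * f D;
  bracket_tied_circle : forall D D' x,
    circle_added x D D' -> class_used (word D) x ->
    f D' = - (A ^+ 2 + Ai ^+ 2) * f D;
  bracket_reidemeister2 : forall D D', reidemeister2 D D' -> f D = f D';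
  bracket_reidemeister3 : forall D D', reidemeister3 D D' -> f D = f D';
  bracket_skein : forall D DA DB u v i e x,
    word D = u ++ (i, Cross e) :: v ->
    strand_class u i x -> strand_class u i.+1 x ->
    word DA = tied_smoothing u v e i x x ->
    word DB = tied_smoothing u v (~~ e) i x x ->
    f D = A * f DA + Ai * f DB;
  bracket_exchange : forall Dp Dm De Df u v i x y,
    word Dp = u ++ (i, Cross true) :: v ->
    word Dm = u ++ (i, Cross false) :: v ->
    strand_class u i x -> strand_class u i.+1 y ->
    word De = tied_smoothing u v true i x y ->
    word Df = tied_smoothing u v false i x y ->
    f Dp + f Dm = (A + Ai) * (f De + f Df) }.

End Brackets.

(* Main.v *)
(* A curl is evaluated by the skein relation at its crossing, both strands of
   which lie in the component carrying the curl: one smoothing splits off a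
   circle tied to that component, the other leaves two opposite zigzags.
   On links with all components tied together the bracket satisfies the Kauffman
   relations, and these determine a function: smoothing removes the crossings,
   and in a stack without crossings the first cap can be pushed down until it
   meets an adjacent cup, with which it forms a circle or a zigzag.
   Finally, the class of a strand is constant along its component, so a tied
   knot is a classical knot up to renaming its only class. *)
Require Import Defs.
From mathcomp Require Import all_boot all_algebra.
From mathcomp Require Import zify ring.
From Stdlib Require Import Relation_Operators.
Local Open Scope ring_scope.

Set Implicit Arguments.
Unset Strict Implicit.
Unset Printing Implicit Defensive.

Import GRing.Theory.

(** * Rows of strands produced by stacks of layers *)

Lemma onth_split (T : Type) (s : seq T) i x :
  onth s i = Some x -> exists p q, s = p ++ x :: q /\ size p = i.
Proof.
elim: s i => [|y s IHs] [|i] //=; first by case=> ->; exists [::], s.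
by case/IHs=> p [q [-> <-]]; exists (y :: p), q.
Qed.

Section Diagrams.
Local Open Scope nat_scope.
Variable T : eqType.
Implicit Types (s p q : seq T) (w u v : seq (layer T)) (x y : T).
Implicit Types D : diagram T.

Lemma run_cons s l w : run s (l :: w) = obind (fun s' => run s' w) (run_layer s l).
Proof. by []. Qed.

Lemma run_cat s u v : run s (u ++ v) = obind (fun s' => run s' v) (run s u).
Proof.
elim: u s => [|l u IHu] s //; rewrite cat_cons !run_cons.
by case: run_layer => //= s'; apply: IHu.
Qed.

Lemma run_rcons s w l : run s (rcons w l) = obind (fun s' => run_layer s' l) (run s w).
Proof.
by rewrite -cats1 run_cat; case: run => //= s'; case: run_layer.
Qed.

Lemma run_layer_cup p q x :
  run_layer (p ++ q) (size p, Cup x) = Some (p ++ x :: x :: q).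
Proof. by rewrite /= size_cat leq_addr take_size_cat ?drop_size_cat. Qed.

Lemma run_layer_cap p q x :
  run_layer (p ++ x :: x :: q) (size p, Cap) = Some (p ++ q).
Proof. by rewrite /= take_size_cat ?drop_size_cat ?eqxx. Qed.

Lemma diagram_run D : run [::] (word D) = Some [::].
Proof. by case: D => w /= /andP[_ /eqP]. Qed.

Lemma diagram_neq0 D : word D <> [::].
Proof. by case: D => -[]. Qed.

Lemma diagramP w :
  w <> [::] -> run [::] w = Some [::] -> exists D, word D = w.
Proof.
move=> w_neq0 run_w; suff diag_w: is_diagram w by exists (Diagram diag_w).
by rewrite /is_diagram run_w eqxx andbT; case: w w_neq0 run_w.
Qed.

Lemma diagram_eq D D' : word D = word D' -> D = D'.
Proof.
case: D D' => w diag_w [w' diag_w'] /= eq_w; move: diag_w'; rewrite -eq_w.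
by move=> diag_w'; rewrite (bool_irrelevance diag_w diag_w').
Qed.

Lemma diagram_head D : exists x w, word D = (0, Cup x) :: w.
Proof.
have := diagram_run D; have := @diagram_neq0 D.
by case: (word D) => [|[[|i] [x||b]] w] // _ _; exists x, w.
Qed.

Lemma class_used_cat u v x :
  class_used (u ++ v) x <-> class_used u x \/ class_used v x.
Proof.
split=> [[t [i]]|[] [t [i]]].
- rewrite onth_cat; case: ifP => _ ?; first by left; exists t, i.
  by right; exists (t - size u), i.
- move=> uE; exists t, i; rewrite onth_cat; case: ltnP => // le_ut.
  by move: uE; rewrite onth_default.
- move=> vE; exists (size u + t), i.
  by rewrite onth_cat ltnNge leq_addr /= addKn.
Qed.

(** Caps delete strands and crossings permute them, so a stack starting from the empty row can
    acquire a colour only from a cup. *)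
Lemma class_used_run w s x :
  run [::] w = Some s -> x \in s -> class_used w x.
Proof.
elim/last_ind: w s => [|w [i e] IHw] s; first by case=> <-.
rewrite run_rcons; case run_w: (run [::] w) => [s1|] //= run_e x_s.
rewrite -cats1; apply/class_used_cat.
have [x_s1|x_s1] := boolP (x \in s1); first by left; apply: IHw x_s1.
have notin q : {subset q <= s1} -> x \notin q.
  by move=> sub_q; apply: contra x_s1 => /sub_q.
have take_s1: x \notin take i s1 by apply: notin => y /mem_take.
have drop_s1: x \notin drop i s1 by apply: notin => y /mem_drop.
(* The colour is new in the row, so the last layer must be a cup bringing it in; a cap or a crossing
   is contradictory. *)
right; case: e run_e => [y||b].
- case: ifP => // _ [sE]; move: x_s.
  rewrite -sE mem_cat !inE (negPf take_s1) (negPf drop_s1) orbF orbb => /= /eqP->.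
  by exists 0, i.
- case: (drop i s1) drop_s1 => [|y [|z r]] //; rewrite !inE !negb_or.
  case/and3P=> _ _ x_r; case: eqP => // _ [sE]; move: x_s.
  by rewrite -sE mem_cat (negPf take_s1) (negPf x_r).
- case: (drop i s1) drop_s1 => [|y [|z r]] //; rewrite !inE !negb_or.
  case/and3P=> xy xz x_r [sE]; move: x_s.
  by rewrite -sE mem_cat !inE (negPf take_s1) (negPf xy) (negPf xz) (negPf x_r).
Qed.

(** * Constancy of the class along a component *)

Definition point_class D (p : nat * nat) : option T :=
  obind (fun s => onth s p.2) (run [::] (take p.1 (word D))).

Lemma layer_run D t l :
  onth (word D) t = Some l ->
  exists s s', [/\ run [::] (take t (word D)) = Some s,
    run [::] (take t.+1 (word D)) = Some s' & run_layer s l = Some s'].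
Proof.
move=> wl; have [u [v [wE <-]]] := onth_split wl; have := diagram_run D.
rewrite wE take_size_cat // -cat_rcons.
rewrite -(size_rcons u l) take_size_cat // run_cat run_rcons.
case: (run [::] u) => //= s; case run_l: (run_layer s l) => [s'|] // _.
by exists s, s'.
Qed.

Lemma onth_cat_size p q : onth (p ++ q) (size p) = onth q 0.
Proof. by rewrite onth_cat ltnn subnn. Qed.

Lemma onth_cat_sizeS p q : onth (p ++ q) (size p).+1 = onth q 1.
Proof. by rewrite onth_cat ltnNge leqnSn /= subSnn. Qed.

(** Inversion in a uniform shape: every piece exchanges a block [a] for a block [b] and leaves the
    strands [p] on its left and [q] on its right alone. *)
Lemma run_layerP s i e s' :
  run_layer s (i, e) = Some s' ->
  exists p a b q, [/\ s = p ++ a ++ q, s' = p ++ b ++ q, size p = i &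
    match e with
    | Cup x => a = [::] /\ b = [:: x; x]
    | Cap => exists x, a = [:: x; x] /\ b = [::]
    | Cross _ => exists x y, a = [:: x; y] /\ b = [:: y; x]
    end].
Proof.
have drop_size y r : drop i s = y :: r -> size (take i s) = i.
  move=> dropE; rewrite size_takel // leqNgt; apply/negP=> /ltnW.
  by move/drop_oversize; rewrite dropE.
have takeE := cat_take_drop i s.
case: e => [x||b] /=.
- case: leqP => // le_is [<-]; exists (take i s), [::], [:: x; x], (drop i s).
  by rewrite size_takel.
- case: (drop i s) drop_size takeE => [|x [|y r]] // /(_ _ _ erefl) sz sE.
  case: eqP => // eq_xy [<-]; subst y; exists (take i s), [:: x; x], [::], r.
  by split=> //; exists x.
- case: (drop i s) drop_size takeE => [|x [|y r]] // /(_ _ _ erefl) sz sE [<-].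
  by exists (take i s), [:: x; y], [:: y; x], r; split=> //; exists x, y.
Qed.

(** A joining step either follows an untouched strand in [p] or [q], or stays at one piece, where a
    cup or cap has equal ends and a crossing carries each colour across. *)
Lemma joined_class D (m n : nat * nat) :
  joined D m n -> point_class D m = point_class D n.
Proof.
case=> {m n} [t i e j|t i e j|t i x|t i|t i e|t i e];
  move/layer_run=> [s [s' [sE s'E /run_layerP]]];
  case=> p [a [b [q [? ? szp eP]]]]; subst s s';
  rewrite /point_class ![(_, _).1]/= ![(_, _).2]/= ?sE ?s'E /obind /oapp; subst i.
- by move=> lt_jp; rewrite !onth_cat lt_jp.
(* The blocks have sizes [n_in e] and [n_out e], so the index change in [joined_right] is exactly
   the displacement of [q]. *)
- have [-> ->]: n_in e = size a /\ n_out e = size b.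
    by case: e eP {sE s'E} => [?[-> ->]|[?[-> ->]]|?[?[? [-> ->]]]].
  move=> le_j; rewrite !onth_cat.
  rewrite !ifN -?leqNgt ?subn_gt0; try lia.
  by congr (onth q _); lia.
- by case: eP => ? ?; subst a b; rewrite onth_cat_size onth_cat_sizeS.
- by case: eP => y [? ?]; subst a b; rewrite onth_cat_size onth_cat_sizeS.
- by case: eP => y [z [? ?]]; subst a b; rewrite onth_cat_size onth_cat_sizeS.
- by case: eP => y [z [? ?]]; subst a b; rewrite onth_cat_size onth_cat_sizeS.
Qed.

Lemma class_used_point D x :
  class_used (word D) x -> exists2 n, strand_point D n & point_class D n = Some x.
Proof.
case=> t [i] /layer_run-[s [s' [_ s'E /run_layerP]]].
case=> p [a [b [q [_ ? szp [_ ?]]]]]; subst b s' i.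
(* This is the left leg of the cup, visible only at the level above layer [t]. *)
exists (t.+1, size p).
  by exists (p ++ [:: x; x] ++ q); split=> //=; rewrite size_cat /=; lia.
by rewrite /point_class /= s'E /= onth_cat_size.
Qed.

Lemma knot_class_used D x y :
  is_knot D -> class_used (word D) x -> class_used (word D) y -> x = y.
Proof.
move=> knot /class_used_point[p p_D px] /class_used_point[q q_D qy].
suff eq_pq: point_class D p = point_class D q.
  by move: eq_pq; rewrite px qy => -[].
elim: (knot _ _ p_D q_D) => {p q p_D px q_D qy} [p q /joined_class|p|p q _ ->|] //.
by move=> p q r _ -> _ ->.
Qed.

End Diagrams.

(** * Recolouring and local replacement *)

Lemma recolor_word_cat (T T' : eqType) (h : T -> T') u v :
  recolor_word h (u ++ v) = recolor_word h u ++ recolor_word h v.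
Proof. exact: map_cat. Qed.

Lemma recolor_word_id (T : eqType) (h : T -> T) w :
  h =1 id -> recolor_word h w = w.
Proof.
move=> h_id; elim: w => //= -[i e] w ->; congr ((_, _) :: _).
by case: e => //= x; rewrite h_id.
Qed.

(** Uniting a class with itself changes nothing, so between strands of one class a tied smoothing is
    an ordinary one. *)
Lemma tied_smoothing_id u v b i x :
  tied_smoothing u v b i x x = u ++ smoothing b i x ++ v.
Proof.
have merge_id : Defs.merge x x =1 id by move=> z; rewrite /Defs.merge; case: eqP.
by rewrite /tied_smoothing !recolor_word_id.
Qed.

Lemma planar_move_recolor (T T' : eqType) (h : T -> T') a b :
  planar_move a b -> planar_move (recolor_word h a) (recolor_word h b).
Proof.
have n_inE e : n_in (recolor_piece h e) = n_in e by case: e.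
have n_outE e : n_out (recolor_piece h e) = n_out e by case: e.
case=> [i j e e' le_ij|i x|i x|i x e|i e] /=; try by constructor.
by rewrite -(n_inE e) -(n_outE e); apply: move_far; rewrite n_inE.
Qed.

Lemma replaced_recolor (T T' : eqType) (h : T -> T') a b (D D' : diagram T) :
  replaced a b D D' ->
  replaced (recolor_word h a) (recolor_word h b) (recolor h D) (recolor h D').
Proof.
case=> u [v [DE D'E]]; exists (recolor_word h u), (recolor_word h v).
by rewrite /= DE D'E !recolor_word_cat.
Qed.

Lemma run1 (T : eqType) (s : seq T) l : run s [:: l] = run_layer s l.
Proof. by rewrite run_cons; case: run_layer. Qed.

Lemma run2 (T : eqType) (s : seq T) l l' :
  run s [:: l; l'] = obind (fun s' => run_layer s' l') (run_layer s l).
Proof. by rewrite (run_rcons s [:: l]) run1. Qed.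

(** The relations compare given diagrams, so each rewritten stack must first be shown to close up.
    It does when the new part has the same effect as the old one on the row reached by [u]. *)
Lemma replace_exists (T : eqType) (D : diagram T) u w w' v :
  word D = u ++ w ++ v ->
  (forall s s', run [::] u = Some s -> run s w = Some s' -> run s w' = Some s') ->
  u ++ w' ++ v <> [::] ->
  exists D' : diagram T, word D' = u ++ w' ++ v.
Proof.
move=> DE runw' neq0; apply: diagramP => //; have := diagram_run D.
rewrite DE !run_cat; case: (run [::] u) runw' => //= s runw'.
rewrite !run_cat; case run_w: (run s w) => [s'|] //=.
by rewrite (runw' _ _ erefl run_w).
Qed.

(** * Uniqueness of a function satisfying the Kauffman relations *)

Lemma unit_nseq (s : seq unit) : s = nseq (size s) tt.
Proof. by elim: s => //= -[] s <-. Qed.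

(** With a single colour the matching condition at a cap always holds, and whether a layer fits
    becomes arithmetic on the number of strands. *)
Lemma run_layer_unit (s : seq unit) i e :
  run_layer s (i, e) =
    if (i + n_in e <= size s)%N
    then Some (nseq (size s - n_in e + n_out e) tt) else None.
Proof.
have some_nseq (s1 : seq unit) n :
    size s1 = n -> Some s1 = Some (nseq n tt).
  by move=> <-; rewrite {1}[s1]unit_nseq.
case: leqP => [le_is|lt_si].
  case: e le_is => [[]||b] /= le_is; first 1 last.
  - case sE: (drop i s) => [|[] [|[] r]] /=; move: (congr1 size sE);
      rewrite size_drop /=; try lia.
    move=> ?; apply: some_nseq.
    by rewrite size_cat size_takel; lia.
  - case sE: (drop i s) => [|[] [|[] r]] /=; move: (congr1 size sE);
      rewrite size_drop /=; try lia.
    move=> ?; apply: some_nseq.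
    by rewrite size_cat /= size_takel; lia.
  - rewrite ifT; last lia.
    apply: some_nseq; rewrite size_cat /= size_drop size_takel; lia.
case: e lt_si => [[]||b] /= lt_si; first by rewrite ifF //; lia.
all: by case sE: (drop i s) => [|[] [|[] r]] //=; move: (congr1 size sE);
  rewrite size_drop /=; lia.
Qed.

Definition is_cap (T : Type) (l : layer T) := if l.2 is Cap then true else false.
Definition is_cross (T : Type) (l : layer T) :=
  if l.2 is Cross _ then true else false.

(** The top layer must leave the empty row, whereas a cup or a crossing leaves at least two
    strands. *)
Lemma diagram_has_cap (T : eqType) (D : diagram T) : has (@is_cap T) (word D).
Proof.
have := diagram_run D; have := @diagram_neq0 _ D.
case/lastP: (word D) => // w [i [x||b]] _; rewrite run_rcons has_rcons //=;
  case: (run [::] w) => //= s.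
  by case: ifP => // _ [] /(congr1 size); rewrite size_cat /= addnS.
by case: (drop i s) => [|y [|z r]] // [] /(congr1 size); rewrite size_cat /= addnS.
Qed.

Section KauffmanUniqueness.
Variables (R : comPzRingType) (a b d : R).

(** A common form, over any coefficients, for the Kauffman bracket embedded as constants in [c] and
    for the tied bracket on fully tied diagrams. *)
Record skein_function (g : classical_diagram -> R) : Prop := {
  skein_planar : forall w w' D D',
    planar_move w w' -> replaced w w' D D' -> g D = g D';
  skein_circle : forall D, is_circle D -> g D = 1;
  skein_add_circle : forall D D', circle_added tt D D' -> g D' = d * g D;
  skein_cross : forall D DA DB u v i e,
    word D = u ++ (i, Cross e) :: v ->
    word DA = u ++ smoothing e i tt ++ v ->
    word DB = u ++ smoothing (~~ e) i tt ++ v ->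
    g D = a * g DA + b * g DB }.

(** Induction on the number of layers and, for a bounded number of layers, on the height of the
    first cap: each step either removes a cup with a cap or lowers that cap. *)
Lemma crossingless_unique (g h : classical_diagram -> R) :
  skein_function g -> skein_function h ->
  forall D, ~~ has (@is_cross unit) (word D) -> g D = h D.
Proof.
move=> hg hh D; have [n] := ubnP (size (word D)).
elim: n D => // n IHn D; have [m] := ubnP (find (@is_cap unit) (word D)).
elim: m D => // m IHm D lt_m lt_n noX.
(* The first cap cannot act on the empty row, so it has a layer below it; this is neither a cap nor
   a crossing, hence a cup. *)
have [u [j [i [v [wE nocap]]]]] : exists u j i v,
    word D = u ++ [:: (j, Cup tt); (i, Cap)] ++ v /\ ~~ has (@is_cap unit) u.
  have := diagram_has_cap D; move: (diagram_run D) noX.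
  move: (word D) => w run_w noX /split_find def_w.
  case: def_w run_w noX => -[i [x||b']] // w1 w2 _.
  case/lastP: w1 => [|u [j [[]||b']]]; first by case: (i).
  - rewrite has_rcons => nocap _ _; exists u, j, i, w2.
    by rewrite !cat_rcons.
  - by rewrite has_rcons.
  - by rewrite !(has_cat, has_rcons).
(* If nothing else is present the diagram is the circle; otherwise deleting the pair leaves a
   nonempty stack, as a diagram must be. *)
have [uv0|uv_neq0] := eqVneq (size u + size v)%N 0.
  have [u0 v0] : u = [::] /\ v = [::].
    by case: (u) (v) uv0 => [|? ?] [|? ?].
  suff circ_D: is_circle D by rewrite (skein_circle hg) ?(skein_circle hh).
  exists tt; rewrite wE u0 v0 /=; have := diagram_run D; rewrite wE u0 v0.
  by case: (j) => // [] /=; case: (i) => [|[]].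
have {}noX : ~~ has (@is_cross unit) (u ++ v).
  by move: noX; rewrite wE !has_cat /=.
have szD' D' : word D' = u ++ v -> (size (word D')).+2 = size (word D).
  by move=> ->; rewrite wE !size_cat /= !addnS.
set cupcap := [:: (j, Cup tt); (i, Cap)] in wE.
have run_cupcap s s' : run s cupcap = Some s' ->
    [/\ j <= size s, i <= size s & s' = s]%N.
  rewrite run2 run_layer_unit subn0 addn0; case: leqP => // le_j.
  rewrite /obind /oapp run_layer_unit size_nseq.
  case: leqP => //= le_i [<-].
  by rewrite addn2 subn2 addn0 [s in RHS]unit_nseq; split=> //; lia.
have zigzag : planar_move cupcap [::] -> g D = h D.
  move=> mv; have [||D' D'E] := replace_exists (w' := [::]) wE.
  - by move=> s s' _ /run_cupcap[_ _ ->].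
  - by move=> uv0; rewrite -size_cat [u ++ v]uv0 in uv_neq0.
  have rep : replaced cupcap [::] D D' by exists u, v.
  rewrite (skein_planar hg mv rep) (skein_planar hh mv rep); apply: IHn.
    by have := szD' _ D'E; lia.
  by rewrite D'E.
(* Exchanging the cup with a distant cap keeps the number of layers and puts the first cap one layer
   lower. The far move may have to be read backwards, whence the disjunction; [bounds] makes the
   exchanged layers fit. *)
have far i' j' (w' := [:: (i', Cap); (j', Cup tt)]) :
    planar_move cupcap w' \/ planar_move w' cupcap ->
    (forall n, j <= n -> i <= n -> i'.+2 <= n /\ j'.+2 <= n)%N -> g D = h D.
  move=> mv bounds; have [||D' D'E] := replace_exists (w' := w') wE.
  - move=> s s' _ /run_cupcap[le_j le_i ->].
    have [le_i' le_j'] := bounds _ le_j le_i.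
    rewrite run2 run_layer_unit addn2 le_i' /obind /oapp.
    rewrite run_layer_unit size_nseq [s in RHS]unit_nseq /=.
    set k := size s in le_i' le_j' *; rewrite ifT; last lia.
    by congr (Some (nseq _ _)); lia.
  - by move/(congr1 size); rewrite !size_cat /=; lia.
  have DD' k : skein_function k -> k D = k D'.
    by move=> hk; case: mv => mv; last apply/esym; apply: (skein_planar hk mv);
      exists u, v.
  rewrite (DD' g) ?(DD' h) //; apply: IHm.
  - move: lt_m; rewrite wE D'E !find_cat (negPf nocap) /=; lia.
  - suff <- : size (word D) = size (word D') by [].
    by rewrite wE D'E !size_cat.
  - by rewrite D'E !has_cat /= -has_cat.
(* Equal positions give a circle, positions differing by one give a zigzag, and all others are far
   apart. *)
have [eq_ij|/eqP neq_ij] := eqVneq i j.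
  have [||D' D'E] := replace_exists (w' := [::]) wE.
  - by move=> s s' _ /run_cupcap[_ _ ->].
  - by move=> uv0; rewrite -size_cat [u ++ v]uv0 in uv_neq0.
  have rep : circle_added tt D' D.
    by exists i, u, v; rewrite wE /cupcap -eq_ij.
  rewrite (skein_add_circle hg rep) (skein_add_circle hh rep).
  congr (_ * _); apply: IHn; last by rewrite D'E.
  by have := szD' _ D'E; lia.
have [eq_i|/eqP neq_i] := eqVneq i j.+1.
  by apply: zigzag; rewrite /cupcap eq_i; apply: move_zigzag_r.
have [eq_j|/eqP neq_j] := eqVneq j i.+1.
  by apply: zigzag; rewrite /cupcap eq_j; apply: move_zigzag_l.
have [lt_ij|le_ji] := ltnP i j.
  apply: (far i (j - 2)%N); last by move=> k; lia.
  left; have -> : (j - 2 = j - n_in (@Cap unit) + n_out (@Cap unit))%N.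
    by rewrite addn0.
  by apply: move_far => /=; lia.
apply: (far (i - 2)%N j); last by move=> k; lia.
(* The cap lies to the right of the cup: before the cup opens its two strands, the cap sits at
   [i - 2], and the far move leads from the exchanged pair back to the given one. *)
right; rewrite /cupcap.
have -> : i = (i - 2 - n_in (Cup tt) + n_out (Cup tt))%N by rewrite /=; lia.
have -> : (i - 2 - n_in (Cup tt) + n_out (Cup tt) - 2 = i - 2)%N by rewrite /=; lia.
by apply: move_far => /=; lia.
Qed.

(** Induction on the number of crossings, each smoothing having one crossing fewer. *)
Theorem skein_function_unique (g h : classical_diagram -> R) :
  skein_function g -> skein_function h -> g =1 h.
Proof.
move=> hg hh D; have [n] := ubnP (count (@is_cross unit) (word D)).
elim: n D => // n IHn D; have := boolP (has (@is_cross unit) (word D)).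
case=> [hasX|noX _]; last exact: crossingless_unique.
have [u [i [e [v wE]]]] : exists u i e v, word D = u ++ (i, Cross e) :: v.
  move: (word D) hasX => w /split_find[[i [x||e]] // u v _ _].
  by exists u, i, e, v; rewrite cat_rcons.
rewrite wE count_cat /= => lt_n.
have smooth r : exists D' : classical_diagram,
    word D' = u ++ smoothing r i tt ++ v.
  apply: (replace_exists (w := [:: (i, Cross e)]) wE).
  - move=> s s' _; rewrite run1 run_layer_unit /=; case: leqP => // le_i [<-].
    case: r; rewrite /smoothing.
      rewrite /= [s in LHS]unit_nseq; set k := size s in le_i *.
      by congr (Some (nseq _ _)); lia.
    rewrite run2 run_layer_unit le_i /obind /oapp run_layer_unit size_nseq /=.
    set k := size s in le_i *; rewrite ifT; last lia.
    by congr (Some (nseq _ _)); lia.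
  (* A diagram cannot begin with a crossing, so [u] is nonempty and so is the smoothed stack. *)
  - have := diagram_run D; rewrite wE.
    by case: (u); case: (i).
have [DA DAE] := smooth e; have [DB DBE] := smooth (~~ e).
rewrite (skein_cross hg wE DAE DBE) (skein_cross hh wE DAE DBE).
have smallX r : (count (@is_cross unit) (u ++ smoothing r i tt ++ v) < n)%N.
  by rewrite !count_cat; case: r => /=; lia.
by rewrite !IHn // ?DAE ?DBE.
Qed.

End KauffmanUniqueness.

(** * Evaluation of curls *)

(** After the crossing, the closing cap meets the incoming strand and one leg of the new cup, which
    forces their colours to agree. *)
Lemma curl_strand (T : eqType) (s s' : seq T) e r i x :
  run s (curl e r i x) = Some s' -> exists p q, s = p ++ x :: q /\ size p = i.
Proof.
have run3 (t : seq T) l1 l2 l3 : run t [:: l1; l2; l3] =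
    obind (fun t' => run t' [:: l2; l3]) (run_layer t l1) by [].
case: r; rewrite /curl run3; case run_l: run_layer => [s1|] //=.
  case/run_layerP: run_l => p0 [_ [_ [q0 [-> -> szp0 [-> ->]]]]].
  case/lastP: p0 szp0 => [|p y] //; rewrite size_rcons => -[<-].
  rewrite cat_rcons drop_size_cat // take_size_cat //=.
  rewrite -cat_rcons -(size_rcons p x) drop_size_cat //.
  by case: eqP => // -> _; exists p, q0; rewrite cat_rcons.
case/run_layerP: run_l => p [_ [_ [q0 [-> -> <- [-> ->]]]]].
rewrite -cat_rcons -(size_rcons p x) drop_size_cat // take_size_cat //.
case: q0 => [|y q] //; rewrite /= cat_rcons drop_size_cat //.
by case: eqP => // <- _; exists p, q.
Qed.

Lemma run_layer_cup_beside (T : eqType) (p q : seq T) x (b : bool) :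
  run_layer (p ++ x :: q) (b + size p, Cup x)%N = Some (p ++ [:: x, x, x & q]).
Proof.
case: b; rewrite ?run_layer_cup //.
by rewrite -cat_rcons add1n -(size_rcons p x) run_layer_cup cat_rcons.
Qed.

(** The booleans choose the side of the strand: equal values describe a circle beside it, different
    values a zigzag in it. *)
Lemma run_cup_cap (T : eqType) (p q : seq T) x (b b' : bool) :
  run (p ++ x :: q) [:: (b + size p, Cup x); (b' + size p, Cap)]%N =
    Some (p ++ x :: q).
Proof.
rewrite run2 run_layer_cup_beside /obind /oapp; case: b'; rewrite ?run_layer_cap //.
by rewrite -cat_rcons add1n -(size_rcons p x) run_layer_cap cat_rcons.
Qed.

(** Since [a * b = 1], the term [- a * b ^+ 2] equals [- b] and cancels the contribution of the
    other smoothing. *)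
Lemma curl_scalar (R : comPzRingType) (a b z : R) :
  a * b = 1 -> a * (- (a ^+ 2 + b ^+ 2) * z) + b * z = - a ^+ 3 * z.
Proof. by move=> ab1; ring: ab1. Qed.

Section TiedBracket.
Variables (f : tied_diagram -> bracket_ring) (hf : is_tied_bracket f).
Local Notation A := (varA%:P : bracket_ring).
Local Notation Ai := (varAi%:P : bracket_ring).

Lemma A_mulV : A * Ai = 1.
Proof. by rewrite -polyCM varA_mulV. Qed.

Lemma Ai_mulV : Ai * A = 1.
Proof. by rewrite mulrC A_mulV. Qed.

Lemma curl_skein e (D D' : tied_diagram) :
  curl_inserted e D D' ->
  f D' = (if e then - A ^+ 3 else - Ai ^+ 3) * f D.
Proof.
case=> r [i [x [u [v [DE D'E]]]]].
have [s [p [q [run_u sE szp]]]] : exists s p q,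
    [/\ run [::] u = Some s, s = p ++ x :: q & size p = i].
  have := diagram_run D'; rewrite D'E run_cat; case: run => //= s.
  rewrite run_cat; case run_c: run => [s'|] // _.
  by have [p [q [sE szp]]] := curl_strand run_c; exists s, p, q.
(* The circle split off has a colour already present in [D], so it counts as tied and does not
   contribute [c]. *)
have used_x : class_used (word D) x.
  rewrite DE; apply/class_used_cat; left; apply: class_used_run run_u _.
  by rewrite sE mem_cat mem_head orbT.
(* [j] is the position of the cup and cap of the kink and [k] that of its crossing; this treats both
   sides at once. *)
pose j := (r + i)%N; pose k := (~~ r + i)%N.
have curlE : curl e r i x = [:: (j, Cup x); (k, Cross e); (j, Cap)].
  by rewrite /j /k; case: (r).
have insert w : run s w = Some s -> exists Dw : tied_diagram, word Dw = u ++ w ++ v.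
  move=> run_w; apply: (@replace_exists _ D _ [::]) => //.
    by move=> s1 s2; rewrite run_u => -[<-] [<-].
  move=> uwv0; have uv0 : u ++ v = [::].
    by case: (u) (v) (w) uwv0 => [|? ?] [|? ?] [|? ?].
  by have := @diagram_neq0 _ D; rewrite DE.
have cup_cap (b b' : bool) : run s [:: (b + i, Cup x); (b' + i, Cap)]%N = Some s.
  by rewrite sE -szp run_cup_cap.
(* [DO] is the upright smoothing, with the circle. [DN] is the other one, with two zigzags, and [DM]
   is what remains after straightening the first. *)
have [DO DOE] := insert _ (cup_cap r r).
have [DM DME] := insert _ (cup_cap (~~ r) r).
have [DN DNE] : exists DN : tied_diagram,
    word DN = u ++ [:: (j, Cup x); (k, Cap); (k, Cup x); (j, Cap)] ++ v.
  apply: insert; rewrite -[_ :: _]/([:: _; _] ++ [:: _; _]) run_cat.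
  by rewrite !cup_cap /obind /oapp cup_cap.
have fDO : f DO = - (A ^+ 2 + Ai ^+ 2) * f D.
  by apply: (bracket_tied_circle hf _ used_x); exists j, u, v.
have zigzag j' k' : j' = k'.+1 \/ k' = j'.+1 ->
    planar_move [:: (j', Cup x); (k', Cap)] [::].
  by case=> ->; constructor.
have jk : j = k.+1 \/ k = j.+1 by rewrite /j /k; case: (r); [left|right].
have fDN : f DN = f D.
  apply: (bracket_isotopy hf); apply: (@iso_trans _ _ DM).
    by apply: iso_planar (zigzag _ _ jk) _; exists u, ([:: (k, Cup x); (j, Cap)] ++ v).
  by apply: iso_planar (zigzag k j _) _; [case: jk; auto | exists u, v].
(* Above the cup three neighbouring strands have colour [x], and the crossing uses two of them, so
   the skein relation for one class applies. *)
have strand (b : bool) : strand_class (rcons u (j, Cup x)) (b + k)%N x.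
  exists (p ++ [:: x, x, x & q]); split.
    by rewrite run_rcons run_u sE /j -szp /obind /oapp run_layer_cup_beside.
  rewrite /k -szp addnA onth_cat ltnNge leq_addl addnK.
  by case: (r) b => -[].
have skein DA DB :
    word DA = rcons u (j, Cup x) ++ smoothing e k x ++ (j, Cap) :: v ->
    word DB = rcons u (j, Cup x) ++ smoothing (~~ e) k x ++ (j, Cap) :: v ->
    f D' = A * f DA + Ai * f DB.
  move=> DAE DBE.
  apply: (@bracket_skein _ hf D' DA DB (rcons u (j, Cup x)) ((j, Cap) :: v) k e x);
    rewrite ?tied_smoothing_id //.
  - by rewrite D'E curlE cat_rcons.
  - exact: (strand false).
  - exact: (strand true).
(* The A-smoothing is upright for a positive crossing and a cap below a cup for a negative one, so
   the sign exchanges [DO] and [DN], hence [A] and [Ai]. *)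
case: e curlE D'E skein => _ _ skein.
- have -> := skein DO DN; rewrite ?cat_rcons ?DOE ?DNE //.
  by rewrite fDO fDN (curl_scalar _ A_mulV).
- have -> := skein DN DO; rewrite ?cat_rcons ?DOE ?DNE //.
  by rewrite fDO fDN addrC [varA%:P ^+ 2 + _]addrC (curl_scalar _ Ai_mulV).
Qed.

(** * Fully tied diagrams and knots *)

Lemma class_used_tie_all (D : classical_diagram) :
  class_used (word (tie_all D)) 0%N.
Proof.
have [[] [w wE]] := diagram_head D; exists 0%N, 0%N.
by rewrite /= wE.
Qed.

(** With a single class every added circle is tied and every crossing falls under the skein relation
    for one class. *)
Lemma skein_tie_all :
  skein_function A Ai (- (A ^+ 2 + Ai ^+ 2)) (f \o tie_all).
Proof.
split=> /= [w w' D D' mv rep|D [x DE]|D D' [i rep]|D DA DB u v i e DE DAE DBE].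
- apply: (bracket_isotopy hf); apply: iso_planar (planar_move_recolor _ mv) _.
  exact: replaced_recolor.
- by apply: (bracket_circle hf); exists 0%N; rewrite /= DE.
- apply: (bracket_tied_circle hf) (class_used_tie_all D).
  by exists i; apply: replaced_recolor rep.
pose h : unit -> nat := fun=> 0%N.
have smoothE r : recolor_word h (smoothing r i tt) = smoothing r i 0%N.
  by case: r.
have [s [run_u lt_i]] : exists s, run [::] u = Some s /\ (i.+1 < size s)%N.
  have := diagram_run D; rewrite DE run_cat; case: run => // s.
  rewrite /obind /oapp run_cons run_layer_unit addn2.
  by case: ltnP => // lt_i _; exists s.
have strand k : (k <= i.+1)%N -> strand_class (recolor_word h u) k 0%N.
  move=> le_k; exists (map h s); split; first exact: run_recolor run_u.
  rewrite onth_map [s]unit_nseq onth_nseq ifT //.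
  exact: leq_ltn_trans le_k lt_i.
apply: (@bracket_skein _ hf _ _ _ (recolor_word h u) (recolor_word h v) i e 0%N).
- by rewrite /= DE recolor_word_cat.
- by apply: strand; lia.
- exact: strand.
- by rewrite tied_smoothing_id /= DAE !recolor_word_cat smoothE.
- by rewrite tied_smoothing_id /= DBE !recolor_word_cat smoothE.
Qed.

(** Only one class occurs on a knot, so even the constant map to [0] is an admissible renaming. *)
Lemma tied_knot_bracket (D : tied_diagram) :
  is_knot D -> f D = f (tie_all (forget_ties D)).
Proof.
move=> knot; rewrite -(class_renaming hf (h := fun=> 0%N)); last first.
  by move=> x y Dx Dy _; apply: knot_class_used Dx Dy.
congr f; apply: diagram_eq; rewrite /= /recolor_word -map_comp.
by apply: eq_map => -[i []].
Qed.

End TiedBracket.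

(** * Comparison with the Kauffman bracket *)

Lemma skein_kauffman (K : classical_diagram -> laurent) :
  is_kauffman_bracket K ->
  skein_function (varA%:P : bracket_ring) varAi%:P
    (- (varA%:P ^+ 2 + varAi%:P ^+ 2)) (fun D => (K D)%:P).
Proof.
move=> hK; split=> [w w' D D' mv rep|D circ|D D' /(kauffman_add_circle hK) ->|].
- by congr (_%:P); apply: (kauffman_isotopy hK); apply: iso_planar mv rep.
- by rewrite (kauffman_circle hK).
- by rewrite polyCM polyCN polyCD !polyC_exp.
move=> D DA DB u v i e DE DAE DBE.
by rewrite (kauffman_skein hK DE DAE DBE) polyCD !polyCM.
Qed.

Theorem proposition1 (f : tied_diagram -> bracket_ring)
    (hf : is_tied_bracket f)
    (K : classical_diagram -> laurent) (hK : is_kauffman_bracket K) :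
  [/\ forall D D' : tied_diagram, curl_inserted true D D' ->
        f D' = - varA%:P ^+ 3 * f D,
      forall D D' : tied_diagram, curl_inserted false D D' ->
        f D' = - varAi%:P ^+ 3 * f D,
      forall D : tied_diagram, is_knot D -> f D = (K (forget_ties D))%:P
    & forall D : classical_diagram, f (tie_all D) = (K D)%:P].
Proof.
(* Both sides satisfy the same relations over the ring with [c] adjoined; the claim on knots is then
   reduced to this equality. *)
have tie_allE D : f (tie_all D) = (K D)%:P.
  exact: skein_function_unique (skein_tie_all hf) (skein_kauffman hK) D.
split=> // [D D'|D D'|D knot]; try exact: curl_skein.
by rewrite (tied_knot_bracket hf knot).
Qed.
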